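(* Let $n\ge2$, let $\mathbf{x}\in\mathbb{R}^n$ satisfy $x_n=\max_{1\le i\le n}x_i$, and let $\mathbf{s}=\mathsf{S}(\mathbf{x})$ with $\mathsf{S}(\mathbf{x})_i=\exp(x_i)/\sum_{j=1}^n\exp(x_j)$. Let $\mathbf{y}=[x_1-x_n,\dots,x_{n-1}-x_n]^\top\in\mathbb{R}^{n-1}$ and let $\mathsf{Z}:\mathbb{R}^{n-1}\to\mathbb{R}^{n-1}$ be the reduced softmax $\mathsf{Z}(\mathbf{y})_i=\exp(y_i)/\big(1+\sum_{j=1}^{n-1}\exp(y_j)\big)$. Define $$\zeta(\mathbf{x})=\frac{4\,\|\mathbf{J}_{\mathsf{Z}}(\mathbf{y})\|_{\infty,1}}{\|\mathbf{J}_{\mathsf{S}}(\mathbf{x})\|_{\infty,1}}.$$ Then $$\zeta(\mathbf{x})\le\begin{cases}\dfrac{4}{1+s_n},&0<s_n\le1/3,\\[2mm]\dfrac{1}{s_n},&1/3<s_n\le1.\end{cases}$$ Moreover, $\lim_{n\to\infty}\zeta(\mathbf{1})=4$, where $\mathbf{1}\in\mathbb{R}^n$ is the vector of all ones.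
   Context: $\mathbf{J}_f(\mathbf{v})$ is the Jacobian matrix of $f$ at $\mathbf{v}$ and $\|\cdot\|_{\infty,1}$ is the $\ell_\infty\to\ell_1$ operator norm; $\|\mathbf{J}_f(\mathbf{v})\|_{\infty,1}$ is the absolute $\ell_\infty\to\ell_1$ condition number of $f$ at $\mathbf{v}$. *)

(* Defs.v *)
From HB Require Import structures.
From mathcomp Require Import all_boot all_order all_algebra.
From mathcomp Require Import all_classical all_reals all_analysis.
Set Implicit Arguments.
Unset Strict Implicit.
Unset Printing Implicit Defensive.
Import Order.TTheory GRing.Theory Num.Theory.
Import numFieldNormedType.Exports.
Local Open Scope classical_set_scope.
Local Open Scope ring_scope.

Definition l1norm (R : realType) (n : nat) (v : 'rV[R]_n) : R :=
  \sum_(j < n) `|v 0 j|.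

(* The library norm `|v| of a row vector is max_j |v_j|. Vectors are rows and
   matrices act on the right, which is the convention of [jacobian]: the
   differential of f at p maps v to v *m 'J f p, so 'J f p is the transpose of
   the usual column-vector Jacobian matrix. The set below is nonempty and
   bounded, so [sup] is a genuine supremum. *)
Definition opnorm_inf1 (R : realType) (m n : nat) (A : 'M[R]_(m, n)) : R :=
  sup [set l1norm (v *m A) | v in [set v : 'rV[R]_m | `|v| <= 1]].

Definition softmax (R : realType) (n : nat) (x : 'rV[R]_n) : 'rV[R]_n :=
  \row_i (expR (x 0 i) / \sum_(j < n) expR (x 0 j)).

Definition reduced_softmax (R : realType) (n : nat) (y : 'rV[R]_n) :
    'rV[R]_n :=
  \row_i (expR (y 0 i) / (1 + \sum_(j < n) expR (y 0 j))).

(* [lift ord_max i] is i viewed as one of the first n indices of 'I_n.+1. *)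
Definition shift_last (R : realType) (n : nat) (x : 'rV[R]_n.+1) : 'rV[R]_n :=
  \row_i (x 0 (lift ord_max i) - x 0 ord_max).

Definition zeta (R : realType) (n : nat) (x : 'rV[R]_n.+1) : R :=
  4 * opnorm_inf1 (jacobian (@reduced_softmax R n) (shift_last x))
  / opnorm_inf1 (jacobian (@softmax R n.+1) x).

(* Main.v *)
Require Import Defs.
From HB Require Import structures.
From mathcomp Require Import all_boot all_order all_algebra.
From mathcomp Require Import all_classical all_reals all_analysis.
From mathcomp Require Import ring lra.
Set Implicit Arguments.
Unset Strict Implicit.
Unset Printing Implicit Defensive.
Import Order.TTheory GRing.Theory Num.Theory.
Import numFieldNormedType.Exports.
Local Open Scope classical_set_scope.
Local Open Scope ring_scope.

(** Both Jacobians have the form diag(w) - w w^T, with w = s for the softmax and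
    w = (s_1, ..., s_(n-1)) for the reduced one, so the image of v has l1 norm
    sum_i w_i |v_i - m| with m = <w, v>. Over the unit cube this is at most the
    total mass W of w, and for a vector of signs it is at least W - m^2. As all
    weights are at most s_n, some signs achieve |m| <= s_n; hence the norm of the
    softmax Jacobian is at least 1 - s_n^2, and the choice of the sign + on the
    last coordinate only gives 4 s_n (1 - s_n). The norm of the reduced Jacobian
    lies between 1 - s_n - s_n^2 and 1 - s_n. Dividing gives both upper bounds
    and zeta >= 4 (1 - s_n - s_n^2), where s_n = 1/n at the all-ones vector. *)

(** * Differentials of sums, rows, coordinates and the exponential *)

Lemma is_diff_sum_ord (R : numFieldType) (V W : normedModType R) (k : nat)
    (f df : 'I_k -> V -> W) (p : V) :
  (forall i, is_diff p (f i) (df i)) ->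
  is_diff p (fun x => \sum_i f i x) (fun v => \sum_i df i v).
Proof.
move=> fdf.
have -> : (fun x => \sum_i f i x) = \sum_i f i.
  by apply/funext => x; rewrite fct_sumE.
have -> : (fun x => \sum_i df i x) = \sum_i df i.
  by apply/funext => x; rewrite fct_sumE.
elim/big_ind2 : _ => //; first exact: is_diff_cst.
by move=> f1 df1 f2 df2 ? ?; exact: is_diffD.
Qed.

(** A row is a linear combination of the constant basis rows, which reduces the claim to sums of
    scalar multiples. *)
Lemma is_diff_row (R : numFieldType) (V : normedModType R) (k : nat)
    (h dh : 'I_k -> V -> R) (p : V) :
  (forall i, is_diff p (h i) (dh i)) ->
  is_diff p (fun x => \row_i h i x) (fun v => \row_i dh i v).
Proof.
move=> hdh.
have rowE (g : 'I_k -> V -> R) :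
    (fun x => \row_i g i x) = (fun x => \sum_i g i x *: delta_mx (0 : 'I_1) i).
  apply/funext => x; rewrite [LHS]row_sum_delta.
  by apply: eq_bigr => i _; rewrite mxE.
rewrite !rowE; apply: is_diff_sum_ord => i.
have hi := hdh i; apply: DiffDef.
  by apply: differentiableZl; exact: ex_diff.
by rewrite diffZl ?diff_val//; exact: ex_diff.
Qed.

Lemma is_diff_coord (R : numFieldType) (k : nat) (p : 'rV[R]_k) (i : 'I_k) :
  is_diff p (fun x : 'rV[R]_k => x 0 i) (fun x : 'rV[R]_k => x 0 i).
Proof.
apply: DiffDef; first exact: differentiable_coord.
have lin : linear (fun x : 'rV[R]_k => x 0 i : R).
  by move=> a u v; rewrite !mxE.
pose fM := GRing.isLinear.Build _ _ _ _ _ lin.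
pose f : {linear 'rV[R]_k -> R} := HB.pack (fun x : 'rV[R]_k => x 0 i) fM.
by apply: (@diff_lin _ _ _ f); exact: coord_continuous.
Qed.

Lemma is_diff_expR (R : realType) (t : R) :
  is_diff t (@expR R) (fun h => expR t * h).
Proof.
have dexp : derivable (@expR R) t 1 by exact: derivable_expR.
apply: DiffDef; first exact/derivable1_diffP.
rewrite deriv1E// derive1E derive_val; apply/funext => h.
by rewrite /= mulrC.
Qed.

(** * The common Jacobian of both maps *)

(* The common form of both maps: c = 0 gives softmax, c = 1 the reduced one. *)
Definition gsoftmax (R : realType) (n : nat) (c : R) (x : 'rV[R]_n) : 'rV[R]_n :=
  \row_i (expR (x 0 i) / (c + \sum_(j < n) expR (x 0 j))).

Lemma softmaxE (R : realType) (n : nat) : @softmax R n = gsoftmax 0.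
Proof. by apply/funext => x; apply/rowP => i; rewrite !mxE add0r. Qed.

(** By the quotient rule; collecting the terms gives diag(w) - w w^T applied to v. *)
Lemma is_diff_gsoftmax (R : realType) (n : nat) (c : R) (x : 'rV[R]_n) :
  0 < c + \sum_(j < n) expR (x 0 j) ->
  let w := gsoftmax c x in
  is_diff x (gsoftmax c)
    (fun v => \row_i (w 0 i * (v 0 i - \sum_j w 0 j * v 0 j))).
Proof.
move=> D0 w.
have dE i : is_diff x (fun y : 'rV[R]_n => expR (y 0 i))
                      (fun v : 'rV[R]_n => expR (x 0 i) * v 0 i).
  have := is_diff_comp (is_diff_coord x i) (is_diff_expR (x 0 i)); exact.
pose D (y : 'rV[R]_n) := c + \sum_(j < n) expR (y 0 j).
have dD : is_diff x D (fun v : 'rV[R]_n => \sum_j expR (x 0 j) * v 0 j).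
  have := is_diffD (is_diff_cst c x) (is_diff_sum_ord dE).
  by rewrite add0r.
have Dx0 : D x != 0 by rewrite gt_eqF.
have dV : is_diff x (fun y => (D y)^-1)
    (fun v : 'rV[R]_n => - (D x) ^- 2 * \sum_j expR (x 0 j) * v 0 j).
  apply: DiffDef; first by apply: differentiableV => //; exact: ex_diff.
  by rewrite diffV ?diff_val//; exact: ex_diff.
apply: is_diff_eq (is_diff_row (fun i => is_diffM (dE i) dV)) _.
apply/funext => v; apply/rowP => i; rewrite !mxE.
have -> : \sum_j w 0 j * v 0 j = (D x)^-1 * \sum_j expR (x 0 j) * v 0 j.
  by rewrite mulr_sumr; apply: eq_bigr => j _; rewrite mxE -/(D x); ring.
(* Both sides are displayed through [D x] and one common sum, which [field] then treats as atoms. *)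
rewrite -[LHS]/(expR (x 0 i) * (- D x ^- 2 * \sum_j expR (x 0 j) * v 0 j)
   + (D x)^-1 * (expR (x 0 i) * v 0 i)) -[RHS]/(expR (x 0 i) / D x *
   (v 0 i - (D x)^-1 * \sum_j expR (x 0 j) * v 0 j)).
by field.
Qed.

Lemma l1norm_mul_jacobian_gsoftmax (R : realType) (n : nat) (c : R)
    (x v : 'rV[R]_n) :
  0 <= c -> 0 < c + \sum_(j < n) expR (x 0 j) ->
  let w := gsoftmax c x in
  l1norm (v *m jacobian (gsoftmax c) x) =
  \sum_i w 0 i * `|v 0 i - \sum_j w 0 j * v 0 j|.
Proof.
move=> c0 D0 w; have dg := @is_diff_gsoftmax R n c x D0.
rewrite /jacobian mul_rV_lin1 diff_val; apply: eq_bigr => i _.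
rewrite mxE normrM ger0_norm// mxE divr_ge0 ?expR_ge0//; exact: ltW.
Qed.

(** * Centered weighted l1 sums over the unit cube *)

Lemma normr_rV_le1 (R : realType) (n : nat) (v : 'rV[R]_n) :
  (`|v| <= 1) <-> (forall i, `|v 0 i| <= 1).
Proof.
rewrite -[`|v|]/(mx_norm v) mx_normrE; split=> [/bigmax_leP[_ vi] i|vi].
  exact: (vi (0, i)).
by apply/bigmax_leP; split=> // -[i j] _ /=; rewrite ord1.
Qed.

(* With m = <w, v>, use |a| <= (1 + a^2) / 2 for a = v_i - m. *)
Lemma centered_l1_le (R : realType) (n : nat) (w v : 'I_n -> R) :
  (forall i, 0 <= w i) -> \sum_i w i <= 1 -> (forall i, `|v i| <= 1) ->
  \sum_i w i * `|v i - \sum_j w j * v j| <= \sum_i w i.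
Proof.
move=> w0; set W := \sum_i w i => W1 v1; set m := \sum_j w j * v j.
have bound i : w i * `|v i - m| <= w i * (1 + m ^+ 2 / 2) - m * (w i * v i).
  have -> : w i * (1 + m ^+ 2 / 2) - m * (w i * v i) =
            w i * ((1 + m ^+ 2 / 2) - m * v i) by ring.
  apply: ler_wpM2l => //.
  have := sqr_ge0 (`|v i - m| - 1); rewrite sqrrB1 real_normK ?num_real// => h.
  have : `|v i| ^+ 2 <= 1 by rewrite expr_le1.
  rewrite real_normK ?num_real// => vi2.
  by move: h vi2; move: (`|_|) => a; nra.
apply: (le_trans (ler_sum _ (fun i _ => bound i))).
(* The bounds add up to W (1 + m^2 / 2) - m^2, which is at most W since W <= 1. *)
rewrite sumrB -mulr_suml -mulr_sumr -/m -/W.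
have := sqr_ge0 m; nra.
Qed.

(** For a sign v_i, |v_i - m| >= v_i (v_i - m) = 1 - m v_i. Averaging with the weights turns the
    last term into m^2. *)
Lemma centered_l1_ge_sign (R : realType) (n : nat) (w v : 'I_n -> R) :
  (forall i, 0 <= w i) -> (forall i, `|v i| = 1) ->
  \sum_i w i - (\sum_i w i * v i) ^+ 2 <=
  \sum_i w i * `|v i - \sum_j w j * v j|.
Proof.
move=> w0 v1; set m := \sum_j w j * v j.
have -> : \sum_i w i - m ^+ 2 = \sum_i (w i - m * (w i * v i)).
  by rewrite sumrB -mulr_sumr -/m expr2.
apply: ler_sum => i _.
have -> : w i - m * (w i * v i) = w i * (v i * (v i - m)).
  have : v i ^+ 2 = 1 by rewrite -real_normK ?num_real// v1 expr1n.
  by move=> vi2; rewrite mulrBr -expr2 vi2; ring.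
apply: ler_wpM2l => //; apply: le_trans (ler_norm _) _.
by rewrite normrM v1 mul1r.
Qed.

(* Greedy choice: each new term gets the sign opposite to the sum so far. *)
Lemma balancing_signs (R : realType) (n : nat) (w : 'I_n -> R) (s : R) :
  0 <= s -> (forall i, 0 <= w i <= s) ->
  exists v : 'rV[R]_n, (forall i, `|v 0 i| = 1) /\
    `|\sum_i w i * v 0 i| <= s.
Proof.
move=> s0; elim: n w => [|n IH] w ws.
  by exists 0; split=> [[]//|]; rewrite big_ord0 normr0.
have [v [v1 vs]] := IH (fun i => w (lift ord0 i)) (fun i => ws _).
set T := \sum_i _ in vs.
have [e [e1 es]] : exists e : R, `|e| = 1 /\ `|w ord0 * e + T| <= s.
  have /andP[w0 w1] := ws ord0; move: vs; rewrite ler_norml => /andP[? ?].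
  have [T0|T0] := leP 0 T.
    by exists (-1); rewrite normrN1; split=> //; rewrite ler_norml; lra.
  by exists 1; rewrite normr1; split=> //; rewrite ler_norml; lra.
exists (\row_i oapp (fun j => v 0 j) e (unlift ord0 i)); split=> [i|].
  by rewrite mxE; case: unliftP => [j _|_] //=.
rewrite big_ord_recl mxE unlift_none /=; congr (`|_ + _| <= _): es.
by apply: eq_bigr => i _; rewrite mxE liftK.
Qed.

(** * Bounds on the operator norm *)

Lemma gsoftmax_ge0 (R : realType) (n : nat) (c : R) (x : 'rV[R]_n) (i : 'I_n) :
  0 < c + \sum_(j < n) expR (x 0 j) -> 0 <= gsoftmax c x 0 i.
Proof. by move=> D0; rewrite mxE divr_ge0 ?expR_ge0// ltW. Qed.

(** Since c >= 0, the weights have total mass at most 1, so [centered_l1_le] applies. The result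
    bounds the supremum from above and also shows that the set is bounded, as lower bounds on [sup]
    require. *)
Lemma ubound_l1norm_jacobian_gsoftmax (R : realType) (n : nat) (c : R)
    (x : 'rV[R]_n) :
  0 <= c -> 0 < c + \sum_(j < n) expR (x 0 j) ->
  ubound [set l1norm (v *m jacobian (gsoftmax c) x)
         | v in [set v : 'rV[R]_n | `|v| <= 1]] (\sum_i gsoftmax c x 0 i).
Proof.
move=> c0 D0 _ [v /= /normr_rV_le1 v1 <-].
rewrite l1norm_mul_jacobian_gsoftmax//.
apply: centered_l1_le => // [i|]; first exact: gsoftmax_ge0.
under eq_bigr do rewrite mxE.
by rewrite -mulr_suml ler_pdivrMr// mul1r lerDr.
Qed.

Lemma opnorm_gsoftmax_le (R : realType) (n : nat) (c : R) (x : 'rV[R]_n) :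
  0 <= c -> 0 < c + \sum_(j < n) expR (x 0 j) ->
  opnorm_inf1 (jacobian (gsoftmax c) x) <= \sum_i gsoftmax c x 0 i.
Proof.
move=> c0 D0; apply: ge_sup; last exact: ubound_l1norm_jacobian_gsoftmax.
by eexists; exists 0 => //=; rewrite normr0.
Qed.

Lemma opnorm_gsoftmax_ge_sign (R : realType) (n : nat) (c : R)
    (x v : 'rV[R]_n) :
  0 <= c -> 0 < c + \sum_(j < n) expR (x 0 j) -> (forall i, `|v 0 i| = 1) ->
  \sum_i gsoftmax c x 0 i - (\sum_i gsoftmax c x 0 i * v 0 i) ^+ 2 <=
  opnorm_inf1 (jacobian (gsoftmax c) x).
Proof.
move=> c0 D0 v1.
apply: le_trans (centered_l1_ge_sign (fun i => gsoftmax_ge0 i D0) v1) _.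
rewrite -l1norm_mul_jacobian_gsoftmax//; apply: ub_le_sup.
  by eexists; exact: ubound_l1norm_jacobian_gsoftmax.
by exists v => //=; apply/normr_rV_le1 => i; rewrite v1.
Qed.

(** * Comparison of the two norms *)

(** Numerator and denominator of the softmax are divided by the exponential of the last coordinate,
    whose own term becomes the 1. *)
Lemma reduced_softmax_shift_last (R : realType) (n : nat) (x : 'rV[R]_n.+1)
    (i : 'I_n) :
  reduced_softmax (shift_last x) 0 i = softmax x 0 (lift ord_max i).
Proof.
have last0 : expR (x 0 ord_max) != 0 by rewrite gt_eqF ?expR_gt0.
rewrite !mxE (bigD1_ord ord_max)//= expRB.
have -> : \sum_(j < n) expR (shift_last x 0 j) =
    (\sum_(j < n) expR (x 0 (lift ord_max j))) / expR (x 0 ord_max).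
  by rewrite mulr_suml; apply: eq_bigr => j _; rewrite mxE expRB.
by rewrite -[X in _ / (X + _)](divff last0) -mulrDl invfM invrK mulrACA mulVf ?mulr1.
Qed.

(** Both upper bounds hold for every s; the threshold 1/3 only marks where they cross. The lower
    bound serves the limit. *)
Lemma zeta_bounds (R : realType) (n : nat) (x : 'rV[R]_n.+2) :
  (forall i, x 0 i <= x 0 ord_max) ->
  let s := softmax x 0 ord_max in
  [/\ 4 * (1 - s - s ^+ 2) <= zeta x, zeta x <= 4 / (1 + s) & zeta x <= 1 / s].
Proof.
move=> xmax s.
have D0 : 0 < \sum_(j < n.+2) expR (x 0 j).
  rewrite big_ord_recl ltr_wpDr ?expR_gt0//.
  by apply: sumr_ge0 => *; exact: expR_ge0.
have w0 i : 0 < softmax x 0 i by rewrite mxE divr_gt0 ?expR_gt0.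
have ws i : softmax x 0 i <= s.
  by rewrite /s !mxE ler_pM2r ?invr_gt0// ler_expR.
have w1 : \sum_i softmax x 0 i = 1.
  under eq_bigr do rewrite mxE.
  by rewrite -mulr_suml divff// gt_eqF.
have s0 : 0 < s by exact: w0.
have z1 : \sum_i softmax x 0 (lift ord_max i) = 1 - s.
  by rewrite -w1 [in RHS](bigD1_ord ord_max)//= addrAC subrr add0r.
(* Dimension at least 2 leaves a positive weight besides the last one. *)
have s1 : s < 1.
  rewrite -subr_gt0 -z1 big_ord_recl ltr_wpDr//.
  by apply: sumr_ge0 => i _; exact: ltW.
have S0 : 0 < 0 + \sum_(j < n.+2) expR (x 0 j) by rewrite add0r.
have dle := opnorm_gsoftmax_le (lexx 0) S0.
have dge v := opnorm_gsoftmax_ge_sign (v := v) (lexx 0) S0.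
rewrite -softmaxE w1 in dle dge.
have T0 : 0 < 1 + \sum_(j < n.+1) expR (shift_last x 0 j).
  by rewrite ltr_wpDr// sumr_ge0// => *; exact: expR_ge0.
have nle := opnorm_gsoftmax_le ler01 T0.
have nge v := opnorm_gsoftmax_ge_sign (v := v) ler01 T0.
have zE i : gsoftmax 1 (shift_last x) 0 i = softmax x 0 (lift ord_max i).
  exact: reduced_softmax_shift_last.
rewrite (eq_bigr _ (fun i _ => zE i)) z1 in nle nge.
have sqs (m : R) : `|m| <= s -> m ^+ 2 <= s ^+ 2.
  by move=> ms; rewrite -real_normK ?num_real// lerXn2r ?nnegrE// ltW.
have n1 : 1 - s - s ^+ 2 <= opnorm_inf1 (jacobian (gsoftmax 1) (shift_last x)).
  have [v [v1 vs]] := @balancing_signs R n.+1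
    (fun i => softmax x 0 (lift ord_max i)) s (ltW s0)
    (fun i => introT andP (conj (ltW (w0 _)) (ws _))).
  have := nge v v1.
  under eq_bigr do rewrite zE.
  apply: le_trans; rewrite lerD2l lerN2; exact: sqs.
have d1 : 1 - s ^+ 2 <= opnorm_inf1 (jacobian (@softmax R n.+2) x).
  have [v [v1 vs]] := @balancing_signs R n.+2 (fun i => softmax x 0 i) s (ltW s0)
    (fun i => introT andP (conj (ltW (w0 _)) (ws _))).
  apply: le_trans (dge v v1); rewrite lerD2l lerN2; exact: sqs.
have d2 : 4 * s * (1 - s) <= opnorm_inf1 (jacobian (@softmax R n.+2) x).
  (* With + on the last coordinate and - elsewhere, m = s - (1 - s), so 1 - m^2 = 4 s (1 - s). *)
  have := dge (\row_i (if i == ord_max then 1 else -1)).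
  rewrite (bigD1_ord ord_max)//= mxE eqxx mulr1.
  rewrite (eq_bigr (fun i => - softmax x 0 (lift ord_max i))); last first.
    by move=> i _; rewrite mxE eq_sym (negPf (neq_lift _ _)) mulrN1.
  rewrite sumrN z1 -/s => h; apply: le_trans (h _).
    by nra.
  by move=> i; rewrite mxE; case: ifP; rewrite ?normrN1 ?normr1.
have n0 : 0 <= opnorm_inf1 (jacobian (gsoftmax 1) (shift_last x)).
  (* All signs + give m = 1 - s, hence the lower bound (1 - s) s >= 0. *)
  have := nge (const_mx 1); under eq_bigr do rewrite zE [const_mx _ _ _]mxE mulr1.
  rewrite z1 => h; apply: le_trans (h _); last by move=> i; rewrite mxE normr1.
  by rewrite expr2 -[X in X - _]mulr1 -mulrBr mulr_ge0//; lra.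
rewrite /zeta -[@reduced_softmax R n.+1]/(gsoftmax 1).
move: nle n1 n0 d1 d2 dle; set N := opnorm_inf1 _; set D := opnorm_inf1 _.
move=> nle n1 n0 d1 d2 dle.
have Dp : 0 < D by apply: lt_le_trans d1; rewrite subr_gt0 expr_lt1// ltW.
split.
- rewrite ler_pdivlMr// -mulrA ler_pM2l//.
  (* If 1 - s - s^2 >= 0, multiplying it by D <= 1 keeps it below N; otherwise the product is
     nonpositive and N >= 0 suffices. *)
  have [q0|q0] := leP 0 (1 - s - s ^+ 2).
    by apply: le_trans n1; rewrite -[leRHS]mulr1 ler_wpM2l.
  by apply: le_trans n0; rewrite nmulr_rle0// ltW.
- rewrite ler_pdivrMr// mulrAC ler_pdivlMr ?addr_gt0// -mulrA ler_pM2l//.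
  apply: le_trans d1; rewrite -[1 - s ^+ 2](_ : (1 - s) * (1 + s) = _); last by ring.
  by rewrite ler_wpM2r// addr_ge0// ltW.
- rewrite ler_pdivrMr// mulrAC mul1r ler_pdivlMr//; apply: le_trans d2.
  by rewrite -!mulrA ler_pM2l// mulrC ler_pM2l.
Qed.

(** * The case bound and the limit at the all-ones vector *)

Theorem mainTheorem9 (R : realType) :
  (forall (n : nat) (x : 'rV[R]_n.+2),
     (forall i : 'I_n.+2, x 0 i <= x 0 ord_max) ->
     let s := softmax x in
     let sn := s 0 ord_max in
     zeta x <= if sn <= 1 / 3 then 4 / (1 + sn) else 1 / sn) /\
  zeta (const_mx 1 : 'rV[R]_n.+2) @[n --> \oo] --> (4 : R).
Proof.
split=> [n x xmax|].
  by have [_ ? ?] := zeta_bounds xmax; cbv zeta; case: ifP.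
(* [harmonic n.+1] is 1 / (n + 2), the common softmax weight in dimension n + 2. *)
pose s n : R := harmonic n.+1.
have s0 : s n @[n --> \oo] --> (0 : R) by rewrite cvg_shiftS; exact: cvg_harmonic.
have bounds n : 4 * (1 - s n - s n ^+ 2) <=
    zeta (const_mx 1 : 'rV[R]_n.+2) <= 4 / (1 + s n).
  have [] := @zeta_bounds R n (const_mx 1) _ => [i|]; first by rewrite !mxE.
  have -> : softmax (const_mx 1 : 'rV[R]_n.+2) 0 ord_max = s n.
    rewrite mxE; under eq_bigr do rewrite mxE.
    rewrite mxE sumr_const card_ord -mulr_natr invfM mulrA divff ?mul1r//.
  by move=> -> ->.
apply: (@squeeze_cvgr _ _ _ R (fun n => 4 * (1 - s n - s n ^+ 2))
  (fun n => 4 / (1 + s n))).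
- by apply: nearW => n; exact: bounds.
- rewrite [X in _ --> X](_ : _ = 4 * (1 - 0 - 0 * 0)); last by ring.
  apply: cvgMr; apply: cvgB; first by apply: cvgB => //; exact: cvg_cst.
  exact: cvgM.
- rewrite [X in _ --> X](_ : _ = 4 / (1 + 0)); last by rewrite addr0 divr1.
  apply: cvgMr; apply: cvgV; first by rewrite addr0 oner_neq0.
  by apply: cvgD => //; exact: cvg_cst.
Qed.
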